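(* The vector space of abelian relations of the web on $U$ is isomorphic, via $(f_1,\dots,f_d)\mapsto r=\sum_{i=1}^d f_i\prod_{j\neq i}(p-p_j)$ (a polynomial in $p$ of degree $\le d-3$, identified with $(r_0,\dots,r_{d-3})^T$), to the space of families $r=(r_j)_{0\le j\le d-3}$ of holomorphic functions on $U$ satisfying $$I_0\, r'_x+I^0\, r'_y\equiv M\, r,\qquad\text{where } M=-T\,E.$$
   Context: Let $d\ge 3$, let $U\subset\mathbb{C}^2$ be open with coordinates $(x,y)$, and let $F(x,y,p)=\sum_{i=0}^d a_i(x,y)p^{d-i}$ with $a_i$ holomorphic on $U$, $a_0\equiv1$, such that $F(x,y,p)=\prod_{i=1}^d(p-p_i(x,y))$ with holomorphic $p_i$ pairwise distinct at every point of $U$. The planar $d$-web considered is the superposition of the foliations defined by $y'=p_i(x,y)$. An abelian relation is a family $(f_1,\dots,f_d)$ of holomorphic functions on $U$ with $\sum_i f_i\equiv 0$, $\sum_i p_if_i\equiv0$ and $(f_i)'_x+(p_if_i)'_y\equiv 0$ for each $i$. Subscripts $'_x,'_y,'_p$ denote partial derivatives. Matrix notation: a polynomial $P=\sum_{i=0}^k g_ip^i$ with holomorphic coefficients is identified with the column $(g_0,\dots,g_k)^T$; for an integer $h\ge0$, $M(P)$ is the $(h+k+1)\times(h+1)$ matrix of multiplication by $P$ from polynomials of degree $\le h$ to degree $\le h+k$, with entry in row $i$, column $j$ ($0$-based) equal to $g_{i-j}$ if $0\le i-j\le k$ and $0$ otherwise. Put $K=F'_x+pF'_y$, $H=K\,F''_{pp}-K'_pF'_p$,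 $L=K\,F'_p$. Use $M(F)$ of size $(3d-3)\times(2d-3)$, $M((F'_p)^2)$ of size $(3d-3)\times(d-1)$, and $M(L)$, $M(H)$ of size $(3d-3)\times(d-2)$ (with $L,H$ regarded as polynomials of formal degree $\le 2d-1$). For a matrix $X$ with $3d-3$ rows, $X^+$ is the submatrix of its first $d$ rows and $X^-$ that of its last $2d-3$ rows ($M^-(F)$ is triangular with unit diagonal, hence invertible). Let $N$ be the $(d-2)\times(d-2)$ matrix whose only nonzero entries are $N_{j,j+1}=j$ for $1\le j\le d-3$ (1-based indices), representing $r\mapsto r'_p$. Define the $d\times(d-1)$ matrix $B=M^+((F'_p)^2)-M^+(F)(M^-(F))^{-1}M^-((F'_p)^2)$, which has rank $d-1$, and the $d\times(d-2)$ matrix $E=\bigl(M^+(H)-M^+(L)N\bigr)-M^+(F)(M^-(F))^{-1}\bigl(M^-(H)-M^-(L)N\bigr)$. Let $T$ be any $(d-1)\times d$ left inverse of $B$ ($TB=\mathrm{Id}_{d-1}$). $I_0$ is the $(d-1)\times(d-2)$ matrix consisting of $\mathrm{Id}_{d-2}$ followed by a zero row, and $I^0$ the $(d-1)\times(d-2)$ matrix consisting of a zero row followed by $\mathrm{Id}_{d-2}$. *)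

(* Defs.v *)
(* The complex numbers are modelled as R[i] (mathcomp-real-closed `complex`)
   for an arbitrary realType R; R[i]^o is R[i] seen as a normed module over
   itself, so that `differentiable` / `derive` below are COMPLEX
   (C-linear Frechet) differentiability / complex directional derivatives. *)
From HB Require Import structures.
From mathcomp Require Import all_boot all_order all_algebra.
From mathcomp Require Import all_classical all_reals all_analysis.
From mathcomp Require Import complex.
Set Implicit Arguments. Unset Strict Implicit. Unset Printing Implicit Defensive.
Import Order.TTheory GRing.Theory Num.Theory.
Local Open Scope ring_scope.

Notation Cx R := (R[i]^o).
Notation C2 R := ((R[i]^o * R[i]^o)%type).

Definition holo {R : realType} (U : set (C2 R)) (f : C2 R -> Cx R) : Prop :=
  forall z, U z -> differentiable f z.

Definition dx {R : realType} (f : C2 R -> Cx R) (z : C2 R) : Cx R :=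
  derive f z ((1 : Cx R), (0 : Cx R)).
Definition dy {R : realType} (f : C2 R -> Cx R) (z : C2 R) : Cx R :=
  derive f z ((0 : Cx R), (1 : Cx R)).

Definition Fpol {R : realType} {d : nat} (a : 'I_d.+1 -> C2 R -> Cx R)
  (z : C2 R) : {poly R[i]} :=
  \poly_(k < d.+1) (a (inord (d - k)) z : R[i]).
Definition Fxpol {R : realType} {d : nat} (a : 'I_d.+1 -> C2 R -> Cx R)
  (z : C2 R) : {poly R[i]} :=
  \poly_(k < d.+1) (dx (a (inord (d - k))) z : R[i]).
Definition Fypol {R : realType} {d : nat} (a : 'I_d.+1 -> C2 R -> Cx R)
  (z : C2 R) : {poly R[i]} :=
  \poly_(k < d.+1) (dy (a (inord (d - k))) z : R[i]).

Definition Kpol {R : realType} {d} (a : 'I_d.+1 -> C2 R -> Cx R) z :=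
  Fxpol a z + 'X * Fypol a z.
Definition Hpol {R : realType} {d} (a : 'I_d.+1 -> C2 R -> Cx R) z :=
  Kpol a z * (Fpol a z)^`()^`() - (Kpol a z)^`() * (Fpol a z)^`().
Definition Lpol {R : realType} {d} (a : 'I_d.+1 -> C2 R -> Cx R) z :=
  Kpol a z * (Fpol a z)^`().

(* M(P): the m x n matrix of multiplication by P (of formal degree <= k),
   entry (i,j) (0-based) = g_{i-j} if 0 <= i-j <= k, and 0 otherwise. *)
Definition polmx {K : nzRingType} (P : {poly K}) (k m n : nat) : 'M[K]_(m, n) :=
  \matrix_(i < m, j < n) (if (j <= i)%N && (i - j <= k)%N then P`_(i - j) else 0).

Definition toprows {K : nzRingType} {m n : nat} (r : nat) (A : 'M[K]_(m, n))
  : 'M[K]_(r, n) :=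
  \matrix_(i < r, j < n) oapp (fun i' : 'I_m => A i' j) 0 (insub (i : nat)).
Definition botrows {K : nzRingType} {m n : nat} (r : nat) (A : 'M[K]_(m, n))
  : 'M[K]_(r, n) :=
  \matrix_(i < r, j < n) oapp (fun i' : 'I_m => A i' j) 0 (insub (m - r + i)%N).

Definition MF {R : realType} {d} (a : 'I_d.+1 -> C2 R -> Cx R) z :=
  polmx (Fpol a z) d (3 * d - 3) (2 * d - 3).
Definition MFp2 {R : realType} {d} (a : 'I_d.+1 -> C2 R -> Cx R) z :=
  polmx ((Fpol a z)^`() ^+ 2) (2 * d - 2) (3 * d - 3) (d - 1).
Definition ML {R : realType} {d} (a : 'I_d.+1 -> C2 R -> Cx R) z :=
  polmx (Lpol a z) (2 * d - 1) (3 * d - 3) (d - 2).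
Definition MH {R : realType} {d} (a : 'I_d.+1 -> C2 R -> Cx R) z :=
  polmx (Hpol a z) (2 * d - 1) (3 * d - 3) (d - 2).

(* N : (d-2)x(d-2), N_{j,j+1} = j (1-based), i.e. r |-> r'_p *)
Definition Nmx {K : nzRingType} (d : nat) : 'M[K]_(d - 2) :=
  \matrix_(i < d - 2, j < d - 2) (if (j : nat) == i.+1 then (i.+1)%:R else 0).

Definition Bmx {R : realType} {d} (a : 'I_d.+1 -> C2 R -> Cx R) z
  : 'M[R[i]]_(d, d - 1) :=
  toprows d (MFp2 a z)
  - toprows d (MF a z) *m invmx (botrows (2 * d - 3) (MF a z))
      *m botrows (2 * d - 3) (MFp2 a z).

Definition Emx {R : realType} {d} (a : 'I_d.+1 -> C2 R -> Cx R) z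
  : 'M[R[i]]_(d, d - 2) :=
  (toprows d (MH a z) - toprows d (ML a z) *m Nmx d)
  - toprows d (MF a z) *m invmx (botrows (2 * d - 3) (MF a z))
      *m (botrows (2 * d - 3) (MH a z) - botrows (2 * d - 3) (ML a z) *m Nmx d).

Definition I0mx {K : nzRingType} (d : nat) : 'M[K]_(d - 1, d - 2) :=
  \matrix_(i < d - 1, j < d - 2) ((i : nat) == j)%:R.
Definition I0upmx {K : nzRingType} (d : nat) : 'M[K]_(d - 1, d - 2) :=
  \matrix_(i < d - 1, j < d - 2) ((i : nat) == j.+1)%:R.

Definition abelian_relation {R : realType} {d : nat} (U : set (C2 R))
  (p : 'I_d -> C2 R -> Cx R) (f : 'I_d -> C2 R -> Cx R) : Prop :=
  [/\ forall i, holo U (f i),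
      forall z, U z -> \sum_(i < d) f i z = 0,
      forall z, U z -> \sum_(i < d) p i z * f i z = 0
    & forall i z, U z -> dx (f i) z + dy (fun w => p i w * f i w) z = 0].

Definition rpol {R : realType} {d : nat} (p f : 'I_d -> C2 R -> Cx R)
  (z : C2 R) : {poly R[i]} :=
  \sum_(i < d) (f i z : R[i]) *: \prod_(j < d | j != i) ('X - (p j z : R[i])%:P).

Definition Phi {R : realType} {d : nat} (p f : 'I_d -> C2 R -> Cx R)
  : 'I_(d - 2) -> C2 R -> Cx R :=
  fun j z => (rpol p f z)`_j.

Definition solution {R : realType} {d : nat} (U : set (C2 R))
  (a : 'I_d.+1 -> C2 R -> Cx R) (T : C2 R -> 'M[R[i]]_(d - 1, d))
  (r : 'I_(d - 2) -> C2 R -> Cx R) : Prop :=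
  (forall j, holo U (r j)) /\
  forall z, U z ->
    I0mx d *m (\col_j (dx (r j) z : R[i])) + I0upmx d *m (\col_j (dy (r j) z : R[i]))
    = (- (T z *m Emx a z)) *m (\col_j (r j z : R[i])).

(* Main.v *)
Require Import Defs.
From HB Require Import structures.
From mathcomp Require Import all_boot all_order all_algebra.
From mathcomp Require Import all_classical all_reals all_analysis.
From mathcomp Require Import complex ring zify.
Set Implicit Arguments. Unset Strict Implicit. Unset Printing Implicit Defensive.
Import Order.TTheory GRing.Theory Num.Theory.
Import numFieldNormedType.Exports.
Local Open Scope ring_scope.

(* Lagrange interpolation gives [f_i = r(p_i) / F'(p_i)], and the two linear
   conditions on [f] say exactly that [deg r <= d - 3].  Differentiating
   [F(p_i) = 0] yields [K(p_i) = - F'(p_i) ((p_i)_x + p_i (p_i)_y)], whence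
     F'(p_i)^3 ((f_i)_x + (p_i f_i)_y) = (F'^2 (r_x + p r_y) + H r - L r')(p_i).
   So the differential conditions say that [F'^2 (r_x + p r_y) + H r - L r']
   vanishes modulo [F].  Eliminating with the unitriangular block [M^-(F)] is
   reduction modulo [F], so this reads [B (I_0 r_x + I^0 r_y) + E r = 0].
   Applying an arbitrary left inverse [T] loses nothing because [E r] lies in
   the image of [B]: since [deg (K r) <= 2 d - 2], the residues of [K r / F^2]
   sum to zero. *)

(** * Size bounds for polynomial expressions *)

Lemma size_polyM_bound (K : idomainType) (P Q : {poly K}) m n l :
  (size P <= m)%N -> (size Q <= n)%N -> (m + n <= l.+1)%N -> (size (P * Q)%R <= l)%N.
Proof.
by move=> sP sQ mnl; apply: leq_trans (size_polyMleq _ _) _; lia.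
Qed.

Lemma size_polyB_bound (K : idomainType) (P Q : {poly K}) n :
  (size P <= n)%N -> (size Q <= n)%N -> (size (P - Q)%R <= n)%N.
Proof.
by move=> sP sQ; rewrite (leq_trans (size_polyD _ _)) // geq_max size_polyN sP.
Qed.

Lemma size_polyD_bound (K : idomainType) (P Q : {poly K}) n :
  (size P <= n)%N -> (size Q <= n)%N -> (size (P + Q)%R <= n)%N.
Proof. by move=> sP sQ; rewrite (leq_trans (size_polyD _ _)) // geq_max sP. Qed.

Lemma size_deriv_bound (K : idomainType) (P : {poly K}) n :
  (size P <= n)%N -> (size P^`() <= n.-1)%N.
Proof. by move=> sP; apply: leq_trans (size_poly _ _) _; rewrite -!subn1 leq_sub2r. Qed.

(** * Interpolation at [d] distinct nodes and partial fractions over F^2 *)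

Section Interpolation.
Variables (K : fieldType) (d : nat) (t : 'I_d -> K).
Hypothesis t_inj : injective t.

Let F : {poly K} := \prod_(i < d) ('X - (t i)%:P).
Let ell i : {poly K} := \prod_(j < d | j != i) ('X - (t j)%:P).

Lemma nodal_ell i : F = ('X - (t i)%:P) * ell i.
Proof. by rewrite /F (bigD1 i). Qed.

Lemma monic_ell i : ell i \is monic.
Proof. by apply: monic_prod => j _; exact: monicXsubC. Qed.

Lemma monic_nodal : F \is monic.
Proof. by apply: monic_prod => j _; exact: monicXsubC. Qed.

Lemma size_nodal : size F = d.+1.
Proof. by rewrite /F size_prod_XsubC /index_enum -enumT size_enum_ord. Qed.

Lemma size_ell i : size (ell i) = d.
Proof.
have := size_nodal; rewrite (nodal_ell i) size_Mmonic ?monic_ell ?polyXsubC_eq0 //.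
by rewrite size_XsubC => -[].
Qed.

Lemma horner_nodal i : F.[t i] = 0.
Proof. by rewrite (nodal_ell i) !hornerE subrr mul0r. Qed.

Lemma horner_ell_neq i k : k != i -> (ell i).[t k] = 0.
Proof. by move=> ki; rewrite /ell (bigD1 k) //= !hornerE subrr mul0r. Qed.

Lemma horner_deriv_nodal i : F^`().[t i] = (ell i).[t i].
Proof. by rewrite (nodal_ell i) derivM derivXsubC !hornerE; ring. Qed.

Lemma horner_deriv2_nodal i : F^`()^`().[t i] = (ell i)^`().[t i] *+ 2.
Proof.
rewrite (nodal_ell i) derivM derivXsubC derivD !derivM derivXsubC.
by rewrite !poly.derivE !hornerE /=; ring.
Qed.

Lemma deriv_nodal_neq0 i : F^`().[t i] != 0.
Proof.
rewrite horner_deriv_nodal /ell horner_prod; apply/prodf_neq0 => j ji.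
by rewrite !hornerE subr_eq0 (inj_eq t_inj) eq_sym.
Qed.

Lemma poly_roots_eq0 (Q : {poly K}) :
  (size Q <= d)%N -> (forall i, Q.[t i] = 0) -> Q = 0.
Proof.
move=> sQ Q0; apply: (@roots_geq_poly_eq0 _ _ (codom t)).
- by apply/allP => _ /codomP[i ->]; apply/rootP.
- by rewrite map_inj_uniq ?enum_uniq.
- by rewrite size_codom card_ord.
Qed.

Lemma horner_sum_ell (c : 'I_d -> K) k :
  (\sum_i c i *: ell i).[t k] = c k * F^`().[t k].
Proof.
rewrite horner_sum (bigD1 k) //= big1 ?addr0 ?hornerZ ?horner_deriv_nodal //.
by move=> i ik; rewrite hornerZ horner_ell_neq ?mulr0 // eq_sym.
Qed.

Lemma size_sum_ell (c : 'I_d -> K) : (size (\sum_i c i *: ell i)%R <= d)%N.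
Proof.
apply: leq_trans (size_sum _ _ _) _; apply/bigmax_leqP => i _.
by rewrite (leq_trans (size_scale_leq _ _)) // size_ell.
Qed.

Lemma coef_sum_ell (c : 'I_d -> K) : (\sum_i c i *: ell i)`_d.-1 = \sum_i c i.
Proof.
rewrite coef_sum; apply: eq_bigr => i _.
by rewrite coefZ -{1}(size_ell i) -lead_coefE (monicP (monic_ell i)) mulr1.
Qed.

Lemma lagrange_ell (Q : {poly K}) : (size Q <= d)%N ->
  Q = \sum_i (Q.[t i] / F^`().[t i]) *: ell i.
Proof.
move=> sQ; apply/eqP; rewrite -subr_eq0; apply/eqP/poly_roots_eq0 => [|k].
  by rewrite (leq_trans (size_polyD _ _)) // geq_max size_polyN sQ size_sum_ell.
by rewrite hornerD hornerN horner_sum_ell divfK ?subrr ?deriv_nodal_neq0.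
Qed.

(** The values make [F] a factor, leaving a cofactor [A] of size at most [d]. At a node the
    derivative of [A * F] is A(t_i) F'(t_i) with F'(t_i) nonzero, so [A] vanishes at all the nodes
    as well. *)
Lemma double_roots_eq0 (Q : {poly K}) : (size Q <= d.*2)%N ->
  (forall i, Q.[t i] = 0) -> (forall i, Q^`().[t i] = 0) -> Q = 0.
Proof.
move=> sQ Q0 Q'0.
have [||A defQ] := @uniq_roots_prod_XsubC _ Q (codom t).
- by apply/allP => _ /codomP[i ->]; apply/rootP.
- by rewrite uniq_rootsE map_inj_uniq ?enum_uniq.
move: defQ; rewrite big_image /= -/F => defQ.
suff A0 : A = 0 by rewrite defQ A0 mul0r.
have [->//|A0] := eqVneq A 0.
apply: poly_roots_eq0 => [|i].
  move: sQ; rewrite defQ size_Mmonic ?monic_nodal // size_nodal addnS /= -addnn.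
  by rewrite leq_add2r.
apply/(mulIf (deriv_nodal_neq0 i)); rewrite mul0r -(Q'0 i) defQ derivM !hornerE.
by rewrite horner_nodal mulr0 add0r.
Qed.

(* [c i], [b i] are the coefficients of [1/(X - t i)], [1/(X - t i)^2] in the
   partial fraction expansion of [P / F^2]. *)
Lemma sum_residues_eq0 (P : {poly K}) : (size P < d.*2)%N ->
  \sum_i (P^`() * F^`() - P * F^`()^`()).[t i] / F^`().[t i] ^+ 3 = 0.
Proof.
move=> sP.
pose c i := (P^`() * F^`() - P * F^`()^`()).[t i] / F^`().[t i] ^+ 3.
rewrite -/(\sum_i c i).
pose b i := P.[t i] / F^`().[t i] ^+ 2.
have szE i : size (ell i * ell i) = d.*2.-1.
  by rewrite size_Mmonic ?monic_neq0 ?monic_ell // size_ell addnn.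
(* [Q] is F^2 times the difference between P/F^2 and its expected expansion: F^2/(X - t_i) is
   [F * ell i] and F^2/(X - t_i)^2 is [ell i * ell i]. *)
pose Q := P - F * (\sum_i c i *: ell i) - \sum_i b i *: (ell i * ell i).
have sumb k (g : 'I_d -> K) : (forall i, i != k -> g i = 0) ->
    \sum_i b i * g i = b k * g k.
  by move=> g0; rewrite (bigD1 k) //= big1 ?addr0 // => i /g0 ->; rewrite mulr0.
have Q0 : Q = 0.
  apply: double_roots_eq0 => [|k|k].
  - rewrite !(leq_trans (size_polyD _ _)) // geq_max size_polyN.
    apply/andP; split; last first.
      apply: leq_trans (size_sum _ _ _) _; apply/bigmax_leqP => i _.
      by rewrite (leq_trans (size_scale_leq _ _)) // szE leq_pred.
    rewrite !(leq_trans (size_polyD _ _)) // geq_max size_polyN (ltnW sP) /=.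
    rewrite (leq_trans (size_polyMleq _ _)) // size_nodal addSn /= -addnn.
    by rewrite leq_add2l size_sum_ell.
  - rewrite /Q !hornerE horner_nodal mul0r subr0 horner_sum.
    under eq_bigr do rewrite hornerZ.
    rewrite (sumb k) => [|i ik]; last first.
      by rewrite !hornerE horner_ell_neq 1?eq_sym // mul0r.
    have F'0 := deriv_nodal_neq0 k.
    by rewrite !hornerE /b -horner_deriv_nodal /=; field.
  - rewrite /Q !poly.derivE [X in _ - X]raddf_sum.
    under [X in _ - X]eq_bigr do rewrite /= derivZ derivM.
    rewrite !hornerE horner_nodal mul0r addr0 horner_sum_ell horner_sum.
    under eq_bigr do rewrite hornerZ.
    rewrite (sumb k) => [|i ik]; last first.
      by rewrite !hornerE horner_ell_neq 1?eq_sym //; ring.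
    rewrite /c /b horner_deriv_nodal !hornerE horner_deriv2_nodal horner_deriv_nodal /=.
    by have := deriv_nodal_neq0 k; rewrite horner_deriv_nodal => F'0; field.
have szFE i : size (F * ell i) = d.*2.
  rewrite size_Mmonic ?monic_neq0 ?monic_nodal ?monic_ell //.
  by rewrite size_nodal size_ell addSn addnn.
(* In degree 2d - 1 only the monic products [F * ell i] contribute; [P] and the squares
   [ell i * ell i] have lower degree. This coefficient of [Q] is thus minus the sum of the [c i]. *)
have := congr1 (fun q : {poly K} => q`_d.*2.-1) Q0.
rewrite coef0 /Q !coefB nth_default => [|]; last by case: (d) sP.
rewrite coef_sum [X in _ - X]big1 => [|i _]; last first.
  by rewrite coefZ [X in _ * X]nth_default ?mulr0 // szE.
rewrite subr0 sub0r mulr_sumr coef_sum => /eqP; rewrite oppr_eq0 => /eqP sum0.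
rewrite -[RHS]sum0; apply: eq_bigr => i _.
rewrite -scalerAr coefZ -(szFE i) -lead_coefE.
by rewrite (monicP _) ?mulr1 // monicMl ?monic_nodal ?monic_ell.
Qed.

(** Plain interpolation only gives size at most [d]. The Lagrange coefficients of the interpolant
    are the opposites of the residues [c i], so its coefficient of degree d - 1 is minus their sum,
    which is zero. *)
Lemma exists_deriv_nodal_sqr_mod (P : {poly K}) : (size P < d.*2)%N ->
  exists2 b : {poly K}, (size b <= d.-1)%N &
    forall i, (F^`() ^+ 2 * b).[t i] = (P * F^`()^`() - P^`() * F^`()).[t i].
Proof.
move=> sP.
pose c i := (P^`() * F^`() - P * F^`()^`()).[t i] / F^`().[t i] ^+ 3.
exists (- \sum_i c i *: ell i).
  rewrite size_polyN; apply/leq_sizeP => j; rewrite leq_eqVlt => /predU1P[<-|dj].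
    by rewrite coef_sum_ell; exact: sum_residues_eq0.
  by apply/(leq_sizeP _ d); [exact: size_sum_ell | case: (d) dj].
move=> i; rewrite hornerM hornerN horner_sum_ell horner_exp /c !hornerE.
by have F'0 := deriv_nodal_neq0 i; field.
Qed.

(** The coefficient of degree d - 1 is the sum of the [f i]. Once it vanishes, ['X * Q] still has
    size at most [d], and its own Lagrange expansion, read in the same degree, yields the sum of the
    [t i * f i] as the next coefficient of [Q]. *)
Lemma size_sum_ellP (f : 'I_d -> K) : (1 < d)%N ->
  (size (\sum_i f i *: ell i)%R <= d - 2)%N <->
  \sum_i f i = 0 /\ \sum_i t i * f i = 0.
Proof.
move=> d1; set Q := \sum_i f i *: ell i.
have Qd : Q`_d.-1 = \sum_i f i by exact: coef_sum_ell.
have Qd2 : Q`_d.-1 = 0 -> Q`_d.-2 = \sum_i t i * f i.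
  move=> Qd0; have sXQ : (size ('X * Q)%R <= d)%N.
    apply/leq_sizeP => -[|j] dj; first by case: (d) dj d1 => //.
    rewrite coefXM /=; move: dj; rewrite leq_eqVlt => /predU1P[dj|dj].
      by rewrite (_ : j = d.-1) ?Qd0 // dj.
    by apply/(leq_sizeP _ d) => //; exact: size_sum_ell.
  have := congr1 (fun q : {poly K} => q`_d.-1) (lagrange_ell sXQ).
  rewrite coef_sum_ell coefXM -subn1 subn_eq0 leqNgt d1 /= subn1 => ->.
  apply: eq_bigr => i _.
  by rewrite hornerM hornerX horner_sum_ell mulrA mulfK ?deriv_nodal_neq0.
split=> [sQ|[f0 tf0]].
  have Q0 k : (d - 2 <= k)%N -> Q`_k = 0 by move/leq_sizeP: sQ; apply.
  have fd0 : Q`_d.-1 = 0 by apply: Q0; lia.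
  by rewrite -Qd -Qd2 ?fd0 // Q0 //; lia.
apply/leq_sizeP => j dj.
have [dj'|] := leqP d j; first by apply/(leq_sizeP _ d) => //; exact: size_sum_ell.
have [->|] := eqVneq j d.-1; first by rewrite Qd.
have [->|] := eqVneq j d.-2; first by rewrite Qd2 // Qd.
lia.
Qed.

End Interpolation.

(** * Coefficient columns and multiplication matrices *)

Definition polcol {K : nzRingType} (n : nat) (P : {poly K}) : 'cV[K]_n :=
  \col_(i < n) P`_i.

Lemma polcolD (K : nzRingType) n (P Q : {poly K}) :
  polcol n (P + Q) = polcol n P + polcol n Q.
Proof. by apply/matrixP => i j; rewrite !mxE coefD. Qed.

Lemma polcolB (K : nzRingType) n (P Q : {poly K}) :
  polcol n (P - Q) = polcol n P - polcol n Q.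
Proof. by apply/matrixP => i j; rewrite !mxE coefB. Qed.

Lemma polcol_eq0 (K : nzRingType) n (P : {poly K}) : (size P <= n)%N ->
  polcol n P = 0 -> P = 0.
Proof.
move=> sP P0; apply/polyP => i; rewrite coef0.
have [ni|ni] := leqP n i; first by rewrite nth_default // (leq_trans sP).
by have /matrixP/(_ (Ordinal ni) ord0) := P0; rewrite !mxE.
Qed.

Lemma polcol_poly (K : nzRingType) n (u : 'cV[K]_n) :
  polcol n (\sum_(j < n) u j 0 *: 'X^j) = u.
Proof.
apply/matrixP => i j; rewrite !mxE ord1 coef_sum (bigD1 i) //= big1 => [|k ki].
  by rewrite coefZ coefXn eqxx mulr1 addr0.
by rewrite coefZ coefXn eq_sym (inj_eq val_inj) (negbTE ki) mulr0.
Qed.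

Lemma mul_polmx (K : comNzRingType) (P s : {poly K}) k m n :
  (size P <= k.+1)%N -> (size s <= n)%N ->
  polmx P k m n *m polcol n s = polcol m (P * s).
Proof.
move=> sP ss; apply/matrixP => i j; rewrite !mxE mulrC coefM.
transitivity (\sum_(l < n | (l <= i)%N) s`_l * P`_(i - l)).
  rewrite [RHS]big_mkcond; apply: eq_bigr => l _; rewrite !mxE mulrC.
  case: leqP => //= li; last by rewrite mulr0.
  by case: leqP => // kil; rewrite [P`_ _]nth_default // (leq_trans sP).
pose h l := s`_l * P`_(i - l).
(* One sum runs over [l < n] with [l <= i], the other over [l <= i]. In a common range the extra
   terms vanish, since [s] has size at most [n]. *)
rewrite (big_ord_widen_cond (maxn n i.+1) (fun l => (l <= i)%N) h) ?leq_maxl //.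
rewrite (big_ord_widen (maxn n i.+1) h) ?leq_maxr // /h.
rewrite big_mkcond [RHS]big_mkcond; apply: eq_bigr => l _; rewrite ltnS.
rewrite andbC; case: (ltnP l n) => /= nl; first by [].
by case: (leqP l i) => /= _; rewrite ?[s`_ _]nth_default ?mul0r ?(leq_trans ss).
Qed.

Lemma toprows_mul (K : nzRingType) m n l r (A : 'M[K]_(m, n)) (B : 'M[K]_(n, l)) :
  toprows r (A *m B) = toprows r A *m B.
Proof.
apply/matrixP => i j; rewrite !mxE.
under [RHS]eq_bigr do rewrite mxE.
case: (insub _) => [i'|] /=; first by rewrite mxE.
by rewrite big1 // => k _; rewrite mul0r.
Qed.

Lemma botrows_mul (K : nzRingType) m n l r (A : 'M[K]_(m, n)) (B : 'M[K]_(n, l)) :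
  botrows r (A *m B) = botrows r A *m B.
Proof.
apply/matrixP => i j; rewrite !mxE.
under [RHS]eq_bigr do rewrite mxE.
case: (insub _) => [i'|] /=; first by rewrite mxE.
by rewrite big1 // => k _; rewrite mul0r.
Qed.

Lemma toprowsB (K : nzRingType) m n r (A B : 'M[K]_(m, n)) :
  toprows r (A - B) = toprows r A - toprows r B.
Proof.
by apply/matrixP => i j; rewrite !mxE; case: (insub _) => [i'|] /=; rewrite ?mxE ?subrr.
Qed.

Lemma botrowsB (K : nzRingType) m n r (A B : 'M[K]_(m, n)) :
  botrows r (A - B) = botrows r A - botrows r B.
Proof.
by apply/matrixP => i j; rewrite !mxE; case: (insub _) => [i'|] /=; rewrite ?mxE ?subrr.
Qed.

Lemma toprows_polcol (K : nzRingType) m r (P : {poly K}) : (r <= m)%N ->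
  toprows r (polcol m P) = polcol r P.
Proof.
move=> rm; apply/matrixP => i j; rewrite !mxE insubT /=.
  exact: leq_trans (ltn_ord i) rm.
by move=> im; rewrite mxE.
Qed.

Lemma botrows_polcol (K : nzRingType) m r (P : {poly K}) (i : 'I_r) j : (r <= m)%N ->
  botrows r (polcol m P) i j = P`_(m - r + i).
Proof.
move=> rm; rewrite !mxE insubT /=; first by have := ltn_ord i; lia.
by move=> im; rewrite mxE.
Qed.

(** * Elimination of the high-degree rows as reduction modulo [F] *)

Section Reduction.
Variables (K : fieldType) (d : nat) (F : {poly K}).
Hypotheses (d3 : (3 <= d)%N) (monF : F \is monic) (szF : size F = d.+1).

Let MF := polmx F d (3 * d - 3) (2 * d - 3).

(** The common shape of [Bmx] and [Emx], a Schur complement: multiples of [F] are subtracted to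
    clear the rows of degree at least [d], leaving remainders modulo [F]. *)
Definition redmx n (A : 'M[K]_(3 * d - 3, n)) : 'M[K]_(d, n) :=
  toprows d A - toprows d MF *m invmx (botrows (2 * d - 3) MF) *m botrows (2 * d - 3) A.

(** Row [i] of the block carries degree d + i, so the diagonal holds the leading coefficient of [F]
    and the entries below it would be coefficients of index above [d]. Transposing gives the lower
    triangular form used by [det_trig]. *)
Lemma unitmx_botrows : botrows (2 * d - 3) MF \in unitmx.
Proof.
have botE i j : botrows (2 * d - 3) MF i j =
    if (j <= d + i)%N && (d + i - j <= d)%N then F`_(d + i - j) else 0.
  rewrite mxE (_ : 3 * d - 3 - (2 * d - 3) + i = d + i)%N; last by lia.
  rewrite insubT /=; first by have := ltn_ord i; lia.
  by move=> di; rewrite mxE.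
rewrite unitmxE -det_tr det_trig.
  rewrite big1 ?unitr1 // => i _; rewrite mxE botE addnK leq_addl leqnn /=.
  by move/monicP: monF; rewrite lead_coefE szF.
apply/is_trig_mxP => i j ij; rewrite mxE botE.
by case: ifP => //; lia.
Qed.

(** The inverse block produces the coefficients [w] of the quotient [q]: [F * q] matches [Q] in
    every degree from d to 3d - 4, so the top rows carry the remainder. *)
Lemma redmx_polcol n (A : 'M[K]_(3 * d - 3, n)) (u : 'cV_n) (Q : {poly K}) :
  (size Q <= 3 * d - 3)%N -> A *m u = polcol (3 * d - 3) Q ->
  exists q, redmx A *m u = polcol d (Q - F * q) /\ (size (Q - F * q)%R <= d)%N.
Proof.
move=> sQ Au.
pose w := invmx (botrows (2 * d - 3) MF) *m botrows (2 * d - 3) A *m u.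
have [q sq wE] : exists2 q : {poly K}, (size q <= 2 * d - 3)%N & polcol (2 * d - 3) q = w.
  exists (\sum_(j < 2 * d - 3) w j 0 *: 'X^j); last exact: polcol_poly.
  apply: leq_trans (size_sum _ _ _) _; apply/bigmax_leqP => j _.
  by rewrite (leq_trans (size_scale_leq _ _)) // size_polyXn.
have MFw : MF *m w = polcol (3 * d - 3) (F * q) by rewrite -wE mul_polmx ?szF.
exists q; split.
  rewrite /redmx mulmxBl -!mulmxA [invmx _ *m (_ *m _)]mulmxA -/w.
  by rewrite -!toprows_mul Au MFw !toprows_polcol ?polcolB //; lia.
apply/leq_sizeP => j dj; have [j3|j3] := leqP (3 * d - 3) j.
  rewrite nth_default // (leq_trans (size_polyD _ _)) // geq_max size_polyN.
  rewrite (leq_trans sQ) //= (leq_trans (size_polyMleq _ _)) // szF; lia.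
(* Degree [j] is row [j - d] of the bottom block, because 3d - 3 - (2d - 3) = d. *)
have jlt : (j - d < 2 * d - 3)%N by lia.
have : botrows (2 * d - 3) (A *m u) = botrows (2 * d - 3) (MF *m w).
  by rewrite !botrows_mul /w -!mulmxA mulKVmx // unitmx_botrows.
move=> /matrixP/(_ (Ordinal jlt) 0); rewrite Au MFw !botrows_polcol ?coefB /=; try lia.
by rewrite (_ : 3 * d - 3 - (2 * d - 3) + (j - d) = j)%N => [->|]; [rewrite subrr | lia].
Qed.

End Reduction.

(** * Action of [Nmx], [I0mx] and [I0upmx] on coefficient columns *)

Lemma mul_Nmx (K : nzRingType) d (r : {poly K}) : (size r <= d - 2)%N ->
  Nmx d *m polcol (d - 2) r = polcol (d - 2) r^`().
Proof.
move=> sr; apply/matrixP => i j; rewrite !mxE coef_deriv.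
have [i2|i2] := ltnP i.+1 (d - 2); last first.
  rewrite nth_default ?(leq_trans sr) // mul0rn big1 // => k _.
  by rewrite !mxE; case: eqP => [?|_]; rewrite ?mul0r //; have := ltn_ord k; lia.
rewrite (bigD1 (Ordinal i2)) //= big1 ?addr0 => [|k ki].
  by rewrite !mxE eqxx mulr_natl.
by rewrite !mxE; case: eqP => [e|_]; rewrite ?mul0r //; case/eqP: ki; exact: val_inj.
Qed.

Lemma mul_I0mx (K : nzRingType) d (r : {poly K}) : (2 < d)%N -> (size r <= d - 2)%N ->
  I0mx d *m polcol (d - 2) r = polcol (d - 1) r.
Proof.
move=> d2 sr; apply/matrixP => i j; rewrite !mxE.
have [i2|i2] := ltnP i (d - 2); last first.
  rewrite nth_default ?(leq_trans sr) // big1 // => k _.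
  by rewrite !mxE; case: eqP => [?|_]; rewrite ?mul0r //; have := ltn_ord k; lia.
rewrite (bigD1 (Ordinal i2)) //= big1 ?addr0 => [|k ki].
  by rewrite !mxE eqxx mul1r.
by rewrite !mxE; case: eqP => [e|_]; rewrite ?mul0r //; case/eqP: ki; exact: val_inj.
Qed.

Lemma mul_I0upmx (K : nzRingType) d (r : {poly K}) : (2 < d)%N -> (size r <= d - 2)%N ->
  I0upmx d *m polcol (d - 2) r = polcol (d - 1) ('X * r).
Proof.
move=> d2 sr; apply/matrixP => i j; rewrite !mxE coefXM.
case: i => -[|i] id /=.
  by rewrite big1 // => k _; rewrite !mxE /= mul0r.
have i2 : (i < d - 2)%N by lia.
rewrite (bigD1 (Ordinal i2)) //= big1 ?addr0 => [|k ki].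
  by rewrite !mxE /= eqxx mul1r.
rewrite !mxE /= eqSS; case: eqP => [e|_]; rewrite ?mul0r //.
by case/eqP: ki; exact: val_inj.
Qed.

(** With [u] and [v] the partial derivatives of the components of r, the left-hand side of the
    system encodes r_x + p r_y. *)
Lemma transport_polcolP (K : nzRingType) d (u v w : 'I_(d - 2) -> K)
  (A : 'M[K]_(d - 1, d - 2)) : (2 < d)%N ->
  I0mx d *m (\col_j u j) + I0upmx d *m (\col_j v j) = A *m (\col_j w j) <->
  polcol (d - 1) ((\sum_j u j *: 'X^j) + 'X * (\sum_j v j *: 'X^j))
    = A *m polcol (d - 2) (\sum_j w j *: 'X^j).
Proof.
move=> d2.
have colE (h : 'I_(d - 2) -> K) : \col_j h j = polcol (d - 2) (\sum_j h j *: 'X^j).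
  rewrite -[LHS]polcol_poly; congr polcol.
  by apply: eq_bigr => j _; rewrite mxE.
have sz (h : 'I_(d - 2) -> K) : (size (\sum_j h j *: 'X^j)%R <= d - 2)%N.
  apply: leq_trans (size_sum _ _ _) _; apply/bigmax_leqP => j _.
  by rewrite (leq_trans (size_scale_leq _ _)) // size_polyXn.
by rewrite !colE mul_I0mx // mul_I0upmx // polcolD.
Qed.

(** * The system at one point as a vanishing condition at the roots of [F] *)

Section Criterion.
Variables (K : fieldType) (d : nat) (t : 'I_d -> K) (F G : {poly K}).
Hypotheses (d3 : (3 <= d)%N) (t_inj : injective t).
Hypotheses (FE : F = \prod_(i < d) ('X - (t i)%:P)) (szG : (size G <= d.+1)%N).

Let H := G * F^`()^`() - G^`() * F^`().
Let L := G * F^`().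
Let B := redmx F (polmx (F^`() ^+ 2) (2 * d - 2) (3 * d - 3) (d - 1)).
Let E := redmx F (polmx H (2 * d - 1) (3 * d - 3) (d - 2)
                  - polmx L (2 * d - 1) (3 * d - 3) (d - 2) *m Nmx d).

Let szF : size F = d.+1. Proof. by rewrite FE size_nodal. Qed.
Let Ft i : F.[t i] = 0. Proof. by rewrite FE horner_nodal. Qed.
Let monF : F \is monic. Proof. by rewrite FE monic_nodal. Qed.
Let szF' : (size F^`() <= d)%N.
Proof. by apply: (@size_deriv_bound _ _ d.+1); rewrite szF. Qed.
Let szF'2 : (size (F^`() ^+ 2)%R <= (2 * d - 2).+1)%N.
Proof. by rewrite expr2; apply: (size_polyM_bound szF' szF'); lia. Qed.
Let szL : (size L <= (2 * d - 1).+1)%N.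
Proof. by apply: (size_polyM_bound szG szF'); lia. Qed.
Let szH : (size H <= (2 * d - 1).+1)%N.
Proof.
apply: size_polyB_bound.
  by apply: (size_polyM_bound szG (size_deriv_bound szF')); lia.
by apply: (size_polyM_bound (size_deriv_bound szG) szF'); lia.
Qed.

(** The matrix expression is the column of a polynomial of size at most [d], congruent modulo [F] to
    the polynomial being evaluated. It is determined by its values at the [d] roots, where multiples
    of [F] drop out. *)
Let reduced_eq0P (c r : {poly K}) : (size c <= d - 1)%N -> (size r <= d - 2)%N ->
  B *m polcol (d - 1) c + E *m polcol (d - 2) r = 0 <->
  forall i, (F^`() ^+ 2 * c + (H * r - L * r^`())).[t i] = 0.
Proof.
move=> sc sr.
have sr' : (size r^`() <= d - 2)%N.
  by apply: leq_trans (size_deriv_bound sr) (leq_pred _).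
have [] := @redmx_polcol _ d F d3 monF szF _ _ (polcol (d - 1) c) _ _
  (@mul_polmx _ (F^`() ^+ 2) c _ (3 * d - 3) _ szF'2 sc).
  by apply: (size_polyM_bound szF'2 sc); lia.
move=> q1 [Bc sq1].
have [||q2 [Er sq2]] := @redmx_polcol _ d F d3 monF szF _
   (polmx H (2 * d - 1) (3 * d - 3) (d - 2)
                  - polmx L (2 * d - 1) (3 * d - 3) (d - 2) *m Nmx d)
   (polcol (d - 2) r) (H * r - L * r^`()).
- apply: size_polyB_bound.
    by apply: (size_polyM_bound szH sr); lia.
  by apply: (size_polyM_bound szL sr'); lia.
- by rewrite mulmxBl -mulmxA mul_Nmx // !mul_polmx // polcolB.
rewrite /B Bc /E Er -polcolD; set S := F^`() ^+ 2 * c - _ + _.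
have sS : (size S <= d)%N by exact: size_polyD_bound.
have St i : S.[t i] = (F^`() ^+ 2 * c + (H * r - L * r^`())).[t i].
  by rewrite /S !hornerE Ft /=; ring.
split=> [/(polcol_eq0 sS) S0 i|S0]; first by rewrite -St S0 horner0.
rewrite (@poly_roots_eq0 _ _ _ t_inj S) // => [|i]; last by rewrite St.
by apply/matrixP => i j; rewrite !mxE coef0.
Qed.

Lemma reduced_pdeP (T : 'M[K]_(d - 1, d)) (c r : {poly K}) : T *m B = 1%:M ->
  (size c <= d - 1)%N -> (size r <= d - 2)%N ->
  polcol (d - 1) c = - (T *m E) *m polcol (d - 2) r <->
  forall i, (F^`() ^+ 2 * c + (H * r - L * r^`())).[t i] = 0.
Proof.
move=> TB sc sr.
have [|b sb bP] := @exists_deriv_nodal_sqr_mod _ d t t_inj (G * r).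
  apply: (@leq_ltn_trans (2 * d - 2)); last by lia.
  by apply: (size_polyM_bound szG sr); lia.
(* With P = G r, the combination H r - L r' equals P F'' - P' F'; hence the column of [b] is a
   preimage under [B]. *)
have Eb : E *m polcol (d - 2) r = B *m polcol (d - 1) b.
  apply/eqP; rewrite -subr_eq0 addrC -mulmxN; apply/eqP.
  have -> : - polcol (d - 1) b = polcol (d - 1) (- b).
    by apply/matrixP => i j; rewrite !mxE coefN.
  apply/reduced_eq0P => // [|i]; first by rewrite size_polyN subn1.
  rewrite hornerD mulrN hornerN -FE in bP *; rewrite bP.
  by rewrite /H /L !derivM !hornerE /=; ring.
(* Both conditions now say that the column of [c] is minus that of [b], since [T] cancels [B]. *)
rewrite -reduced_eq0P // Eb mulNmx -!mulmxA Eb mulmxA TB mul1mx.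
split=> [->|/eqP]; first by rewrite mulmxN addNr.
rewrite -mulmxDr => /eqP /(congr1 (mulmx T)).
rewrite mulmxA TB mul1mx mulmx0 => /eqP.
by rewrite addr_eq0 => /eqP.
Qed.

End Criterion.

(** * Differentiating polynomials with variable coefficients at a variable point *)

Section PolynomialFamilies.
Variables (K : numFieldType) (V : normedModType K).
Implicit Types (q : V -> K^o) (z v : V).

Definition polfun n (g : 'I_n -> V -> K^o) (w : V) : {poly K} :=
  \sum_(k < n) (g k w : K) *: 'X^k.

Lemma size_polfun n (g : 'I_n -> V -> K^o) w : (size (polfun g w) <= n)%N.
Proof.
apply: leq_trans (size_sum _ _ _) _; apply/bigmax_leqP => j _.
by rewrite (leq_trans (size_scale_leq _ _)) // size_polyXn.
Qed.

(** The sum is written in the ring of functions so that the sum, product and power rules apply to it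
    directly. *)
Lemma polfun_hornerE n (g : 'I_n -> V -> K^o) q :
  (fun w => (polfun g w).[q w] : K^o) = \sum_(k < n) g k * q ^+ k.
Proof.
apply/funext => w; rewrite /polfun horner_sum fct_sumE; apply: eq_bigr => k _.
by rewrite hornerZ hornerXn /= -[RHS]/(g k w * (q ^+ k) w) exprfctE.
Qed.

Lemma differentiable_polfun_horner n (g : 'I_n -> V -> K^o) q z :
  (forall k, differentiable (g k) z) -> differentiable q z ->
  differentiable (fun w => (polfun g w).[q w] : K^o) z.
Proof.
move=> dg dq; rewrite polfun_hornerE; apply: differentiable_sum => k.
apply: differentiableM => //; case: k => -[|k] /= _; last exact: differentiableX.
by rewrite expr0; exact: differentiable_cst.
Qed.

Lemma is_derive_polfun_horner n (g : 'I_n -> V -> K^o) q z v :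
  (forall k, differentiable (g k) z) -> differentiable q z ->
  is_derive z v (fun w => (polfun g w).[q w] : K^o)
   ((polfun (fun k w => 'D_v (g k) w) z).[q z]
    + (polfun g z)^`().[q z] * 'D_v q z).
Proof.
move=> dg dq; rewrite polfun_hornerE.
have Dq : is_derive z v q ('D_v q z) by exact/derivableP/diff_derivable.
have Dg k : is_derive z v (g k) ('D_v (g k) z) by exact/derivableP/diff_derivable.
apply: is_derive_eq; rewrite /polfun horner_sum raddf_sum.
rewrite horner_sum mulr_suml -big_split /=.
apply: eq_bigr => k _.
rewrite derivZ derivXn !hornerZ hornerXn hornerMn hornerXn exprfctE.
by rewrite /GRing.scale /= -mulr_natl; ring.
Qed.

(** Keeps F' within the [polfun] form, so that the chain rule also covers the denominator F'(q). *)
Lemma deriv_polfun n (g : 'I_n.+1 -> V -> K^o) w :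
  (polfun g w)^`() = polfun (fun k w => g (lift ord0 k) w *+ k.+1) w.
Proof.
rewrite /polfun raddf_sum big_ord_recl /= derivZ derivXn mulr0n scaler0 add0r.
by apply: eq_bigr => k _; rewrite derivZ derivXn /= -scalerMnl -scalerMnr.
Qed.
End PolynomialFamilies.

Lemma holo_polfun_horner (R : realType) (U : set (C2 R)) n (g : 'I_n -> C2 R -> Cx R) q :
  (forall k, holo U (g k)) -> holo U q -> holo U (fun w => (polfun g w).[q w]).
Proof.
by move=> hg hq z Uz; apply: differentiable_polfun_horner => [k|]; [exact: hg | exact: hq].
Qed.

Lemma is_derive_quotient (K : numFieldType) (V : normedModType K) (N D : V -> K^o)
  z v (dN dD : K^o) : D z != 0 -> is_derive z v N dN -> is_derive z v D dD ->
  is_derive z v (fun w => N w / D w : K^o) ((dN * D z - N z * dD) / D z ^+ 2).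
Proof.
move=> D0 DN DD.
have DV : is_derive z v (fun w => (D w)^-1 : K^o) (- (D z) ^- 2 *: dD).
  apply: DeriveDef; first by apply: derivableV => //; case: DD.
  by rewrite deriveV ?derive_val //; case: DD.
have := is_deriveM DN DV; rewrite (_ : _ * _ = fun w => N w / D w) //.
move=> H; apply: is_derive_eq; rewrite /GRing.scale /=.
by field.
Qed.

(** [tx] and [ty] stand for the partial derivatives of the root; the hypotheses on [Px] and [Py] are
    implicit differentiation of P(t) = 0. The isolated term in [ty] on the left is matched by the
    summand [Py] of the derivative of [Q]. *)
Lemma transport_identity (K : fieldType) (P Px Py S Sx Sy : {poly K}) (t tx ty : K)
  (Q := Px + 'X * Py) :
  P^`().[t] != 0 -> Px.[t] = - (P^`().[t] * tx) -> Py.[t] = - (P^`().[t] * ty) ->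
  ((Sx.[t] + S^`().[t] * tx) * P^`().[t] - S.[t] * (Px^`().[t] + P^`()^`().[t] * tx))
    / P^`().[t] ^+ 2
  + (t * (((Sy.[t] + S^`().[t] * ty) * P^`().[t]
          - S.[t] * (Py^`().[t] + P^`()^`().[t] * ty)) / P^`().[t] ^+ 2)
     + S.[t] / P^`().[t] * ty)
  = (P^`() ^+ 2 * (Sx + 'X * Sy)
     + ((Q * P^`()^`() - Q^`() * P^`()) * S - Q * P^`() * S^`())).[t] / P^`().[t] ^+ 3.
Proof.
move=> P'0 Pxt Pyt.
by rewrite /Q derivD derivM derivX !hornerE /= Pxt Pyt; field.
Qed.

(** * Transport of r(q) / F'(q) for a simple root q *)

Section Transport.
Variables (R : realType) (U : set (C2 R)) (n m : nat).
Variables (g : 'I_n.+1 -> C2 R -> Cx R) (r : 'I_m -> C2 R -> Cx R).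
Variables (q : C2 R -> Cx R).
Hypotheses (oU : open U) (hg : forall k, holo U (g k)) (hr : forall k, holo U (r k)).
Hypotheses (hq : holo U q) (rootq : forall z, U z -> (polfun g z).[q z] = 0).
Hypothesis (simpleq : forall z, U z -> (polfun g z)^`().[q z] != 0).

Let F z := polfun g z.
Let G z := polfun (fun k => dx (g k)) z + 'X * polfun (fun k => dy (g k)) z.
Let f z : Cx R := (polfun r z).[q z] / (F z)^`().[q z].
Let g' k : C2 R -> Cx R := fun z => g (lift ord0 k) z *+ k.+1.

Let g'E (k : 'I_n) : g' k = (k.+1%:R : R[i]) \*: g (lift ord0 k).
Proof. by apply/funext => z; rewrite /g' /= scaler_nat. Qed.

Let hg' k : holo U (g' k).
Proof. by move=> z Uz; rewrite g'E; apply: differentiableZ; exact: hg. Qed.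

Let F'E z : (F z)^`() = polfun g' z. Proof. exact: deriv_polfun. Qed.

Let dF'E z v : U z ->
  polfun (fun k w => 'D_v (g' k) w) z = (polfun (fun k w => 'D_v (g k) w) z)^`().
Proof.
move=> Uz; rewrite deriv_polfun /polfun; apply: eq_bigr => k _; congr (_ *: _).
by rewrite g'E deriveZ ?scaler_nat //; apply/diff_derivable/hg.
Qed.

Lemma holo_quotient : holo U f.
Proof.
move=> z Uz; apply: differentiableM; first exact: holo_polfun_horner.
apply: differentiableV; last exact: simpleq.
rewrite (_ : (fun w => _) = fun w => (polfun g' w).[q w]); last first.
  by apply/funext => w; rewrite F'E.
exact: (holo_polfun_horner hg').
Qed.

(* Along the foliation [y' = q], [q] itself varies by [- G(q) / F'(q)],
   because [F(q) = 0]. *)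
Lemma transport_quotient z : U z ->
  dx f z + dy (fun w => q w * f w) z =
  ((F z)^`() ^+ 2 * (polfun (fun k => dx (r k)) z + 'X * polfun (fun k => dy (r k)) z)
   + ((G z * (F z)^`()^`() - (G z)^`() * (F z)^`()) * polfun r z
      - G z * (F z)^`() * (polfun r z)^`())).[q z] / (F z)^`().[q z] ^+ 3.
Proof.
move=> Uz.
have Dq v : is_derive z v q ('D_v q z) by apply/derivableP/diff_derivable/hq.
have DF v : (polfun (fun k w => 'D_v (g k) w) z).[q z] =
    - ((F z)^`().[q z] * 'D_v q z).
  have D := is_derive_polfun_horner v (fun k => hg k Uz) (hq Uz).
  apply/eqP; rewrite -addr_eq0 -(@derive_val _ _ _ _ _ _ _ D); apply/eqP.
  (* As [U] is open, F(q) vanishes on a neighbourhood of [z], not just at [z]. *)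
  rewrite -(derive_cst (0 : Cx R) z v); apply: near_eq_derive.
  by apply: filterS (open_nbhs_nbhs (conj oU Uz)) => w Uw; rewrite rootq.
have Df v : is_derive z v f
    ((((polfun (fun k w => 'D_v (r k) w) z).[q z] + (polfun r z)^`().[q z] * 'D_v q z)
      * (F z)^`().[q z] - (polfun r z).[q z] *
     ((polfun (fun k w => 'D_v (g k) w) z)^`().[q z] + (F z)^`()^`().[q z] * 'D_v q z))
     / (F z)^`().[q z] ^+ 2).
  apply: is_derive_quotient; first exact: simpleq.
    exact: (is_derive_polfun_horner v (fun k => hr k Uz) (hq Uz)).
  rewrite (_ : (fun w => _) = fun w => (polfun g' w).[q w]); last first.
    by apply/funext => w; rewrite F'E.
  rewrite -(dF'E _ Uz) F'E.
  exact: (is_derive_polfun_horner v (fun k => @hg' k z Uz) (hq Uz)).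
have Dqf v := is_deriveM (Dq v) (Df v).
rewrite /dx /dy (@derive_val _ _ _ _ _ _ _ (Df _)).
rewrite (_ : (fun w => q w * f w) = q * f) // (@derive_val _ _ _ _ _ _ _ (Dqf _)).
rewrite /GRing.scale /= [f z]/f.
exact: (transport_identity _ _ _ (simpleq Uz) (DF _) (DF _)).
Qed.

End Transport.

(** * Holomorphy of the coefficients of polynomial expressions *)

Section HolomorphicCoefficients.
Variables (R : realType) (U : set (C2 R)).
Implicit Types P Q : C2 R -> {poly R[i]}.

Definition holo_coef P := forall k, holo U (fun z => (P z)`_k : Cx R).

Lemma holo_coefC (c : {poly R[i]}) : holo_coef (fun=> c).
Proof. by move=> k z _; exact: differentiable_cst. Qed.

Lemma holo_coefD P Q : holo_coef P -> holo_coef Q -> holo_coef (fun z => P z + Q z).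
Proof.
move=> hP hQ k z Uz.
rewrite (_ : (fun w => _) = (fun w => (P w)`_k : Cx R) + (fun w => (Q w)`_k : Cx R)).
  by apply: differentiableD; [exact: hP | exact: hQ].
by apply/funext => w; rewrite coefD.
Qed.

Lemma holo_coefM P Q : holo_coef P -> holo_coef Q -> holo_coef (fun z => P z * Q z).
Proof.
move=> hP hQ k z Uz.
rewrite (_ : (fun w => _) = \sum_(j < k.+1)
    (fun w => (P w)`_j : Cx R) * (fun w => (Q w)`_(k - j) : Cx R)).
  by apply: differentiable_sum => j; apply: differentiableM; [exact: hP | exact: hQ].
by apply/funext => w; rewrite coefM fct_sumE.
Qed.

Lemma holo_coef_sum (I : Type) (s : seq I) (B : pred I) (P : I -> C2 R -> {poly R[i]}) :
  (forall i, holo_coef (P i)) -> holo_coef (fun z => \sum_(i <- s | B i) P i z).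
Proof.
move=> hP; elim: s => [|i s IHs].
  by under eq_fun do rewrite big_nil; exact: holo_coefC.
under eq_fun do rewrite big_cons.
by case: (B i) => //; apply: holo_coefD.
Qed.

Lemma holo_coef_prod (I : Type) (s : seq I) (B : pred I) (P : I -> C2 R -> {poly R[i]}) :
  (forall i, holo_coef (P i)) -> holo_coef (fun z => \prod_(i <- s | B i) P i z).
Proof.
move=> hP; elim: s => [|i s IHs].
  by under eq_fun do rewrite big_nil; exact: holo_coefC.
under eq_fun do rewrite big_cons.
by case: (B i) => //; apply: holo_coefM.
Qed.

Lemma holo_coef_polyC (g : C2 R -> Cx R) : holo U g -> holo_coef (fun z => (g z : R[i])%:P).
Proof.
move=> hg [|k] z Uz; under eq_fun do rewrite coefC /=; first exact: hg.
exact: differentiable_cst.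
Qed.

Lemma holo_Phi d (p f : 'I_d -> C2 R -> Cx R) j :
  (forall i, holo U (p i)) -> (forall i, holo U (f i)) -> holo U (Phi p f j).
Proof.
move=> hp hf; apply: (@holo_coef_sum _ _ _ (fun i z => _)) => i.
under eq_fun do rewrite -mul_polyC.
apply: holo_coefM; first exact: holo_coef_polyC.
apply: holo_coef_prod => k; under eq_fun do rewrite -polyCN.
apply: holo_coefD; first exact: holo_coefC.
apply: holo_coef_polyC => z Uz; apply: differentiableN; exact: hp.
Qed.
End HolomorphicCoefficients.

Lemma rpol_linear (R : realType) d (p f g : 'I_d -> C2 R -> Cx R) (c : R[i]) z :
  rpol p (fun i w => c * f i w + g i w) z = c *: rpol p f z + rpol p g z.
Proof.
rewrite /rpol scaler_sumr -big_split; apply: eq_bigr => i _.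
by rewrite scalerDl scalerA.
Qed.

(** * Correspondence between abelian relations and solutions *)

Section Web.
Variables (R : realType) (d : nat) (U : set (C2 R)).
Variables (a : 'I_d.+1 -> C2 R -> Cx R) (p : 'I_d -> C2 R -> Cx R).
Variable (T : C2 R -> 'M[R[i]]_(d - 1, d)).
Hypotheses (d3 : (3 <= d)%N) (oU : open U) (ha : forall i, holo U (a i)).
Hypotheses (a0 : forall z, U z -> a ord0 z = 1) (hp : forall i, holo U (p i)).
Hypothesis pP : forall z i j, U z -> i != j -> p i z != p j z.
Hypothesis FP : forall z, U z -> Fpol a z = \prod_(i < d) ('X - (p i z : R[i])%:P).
Hypothesis TB : forall z, U z -> T z *m Bmx a z = 1%:M.

(** Reindexing by powers: [a i] multiplies p^(d - i), whereas [g k] multiplies p^k. *)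
Let g (k : 'I_d.+1) := a (inord (d - k)).
Let t z i : R[i] := p i z.

Let t_inj z : U z -> injective (t z).
Proof. by move=> Uz i j; apply: contra_eq; exact: pP. Qed.

Let FpolE z : Fpol a z = polfun g z.
Proof. exact: poly_def. Qed.

Let KpolE z :
  Kpol a z = polfun (fun k => dx (g k)) z + 'X * polfun (fun k => dy (g k)) z.
Proof.
have FxE : Fxpol a z = polfun (fun k => dx (g k)) z by exact: poly_def.
have FyE : Fypol a z = polfun (fun k => dy (g k)) z by exact: poly_def.
by rewrite /Kpol FxE FyE.
Qed.

Let Fpol_root z i : U z -> (polfun g z).[p i z] = 0.
Proof. by move=> Uz; rewrite -FpolE FP // (horner_nodal (t z)). Qed.

Let Fpol_simple z i : U z -> (polfun g z)^`().[p i z] != 0.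
Proof. by move=> Uz; rewrite -FpolE FP //; exact: (deriv_nodal_neq0 (t_inj Uz)). Qed.

(** A priori p F_y reaches degree d + 1, but its coefficient there is the y-derivative of [a ord0],
    which is constantly 1 on the open set [U]. *)
Let size_Kpol z : U z -> (size (Kpol a z) <= d.+1)%N.
Proof.
move=> Uz; apply: size_polyD_bound; first exact: size_poly.
apply/leq_sizeP => -[|k] dk //; rewrite coefXM /= coef_poly.
case: ltnP => // kd; have -> : k = d by lia.
rewrite subnn; apply: etrans (near_eq_derive _ _) (derive_cst (1 : Cx R) _ _).
apply: filterS (open_nbhs_nbhs (conj oU Uz)) => w Uw.
by rewrite (_ : inord 0 = ord0) ?a0 //; apply/val_inj; rewrite /= inordK.
Qed.

Let EmxE z : Emx a z = redmx (Fpol a z)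
  (polmx (Hpol a z) (2 * d - 1) (3 * d - 3) (d - 2)
   - polmx (Lpol a z) (2 * d - 1) (3 * d - 3) (d - 2) *m Nmx d).
Proof. by rewrite /redmx toprowsB botrowsB toprows_mul botrows_mul. Qed.

Let polcol_polfun n (h : 'I_n -> C2 R -> Cx R) z :
  \col_j (h j z : R[i]) = polcol n (polfun h z).
Proof.
rewrite -[LHS]polcol_poly; congr polcol; rewrite /polfun.
by apply: eq_bigr => k _; rewrite mxE.
Qed.

(** The inverse of [Phi], read off from Lagrange interpolation. *)
Let quot (r : 'I_(d - 2) -> C2 R -> Cx R) i z : Cx R :=
  (polfun r z).[p i z] / (polfun g z)^`().[p i z].

(** The pointwise criterion and the transport formula involve the same value, up to division by
    F'(p_i)^3, which is nonzero because the roots are distinct. *)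
Let solution_at r z : (forall j, holo U (r j)) -> U z ->
  I0mx d *m (\col_j (dx (r j) z : R[i])) + I0upmx d *m (\col_j (dy (r j) z : R[i]))
    = (- (T z *m Emx a z)) *m (\col_j (r j z : R[i])) <->
  forall i, dx (quot r i) z + dy (fun w => p i w * quot r i w) z = 0.
Proof.
move=> hr Uz.
apply: iff_trans (transport_polcolP (fun j => dx (r j) z) (fun j => dy (r j) z)
  (fun j => r j z) _ d3) _.
pose rx := polfun (fun j => dx (r j)) z.
pose ry := polfun (fun j => dy (r j)) z.
have sc : (size (rx + 'X * ry)%R <= d - 1)%N.
  apply: size_polyD_bound; first by rewrite (leq_trans (size_polfun _ _)) //; lia.
  by apply: (size_polyM_bound (leqnn _) (size_polfun _ _)); rewrite size_polyX; lia.
have P := reduced_pdeP d3 (t_inj Uz) (FP Uz) (size_Kpol Uz) (TB Uz) sc (size_polfun r z).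
rewrite -EmxE in P.
apply: iff_trans P _.
split=> rel i; have := rel i;
  rewrite /quot (transport_quotient oU (fun k => ha _) hr (hp i)
    (fun w => @Fpol_root w i) (fun w => @Fpol_simple w i)) //.
  by rewrite -KpolE -FpolE => ->; rewrite mul0r.
rewrite -KpolE -FpolE => /eqP; rewrite mulf_eq0 invr_eq0 expf_eq0 /=.
by rewrite FpolE (negbTE (Fpol_simple _ Uz)) orbF => /eqP.
Qed.
Lemma rpol_horner f i z : U z -> (rpol p f z).[p i z] = f i z * (Fpol a z)^`().[p i z].
Proof. by move=> Uz; rewrite FP //; exact: (horner_sum_ell (t z)). Qed.

Lemma size_rpol f z : abelian_relation U p f -> U z -> (size (rpol p f z) <= d - 2)%N.
Proof.
move=> [_ f0 pf0 _] Uz; apply/(size_sum_ellP (t_inj Uz) (fun i => f i z)); first by lia.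
by split; [exact: f0 | exact: pf0].
Qed.

(** [Phi] keeps only d - 2 coefficients; the degree bound for abelian relations ensures that none is
    lost. *)
Let polfun_Phi f z : abelian_relation U p f -> U z -> polfun (Phi p f) z = rpol p f z.
Proof.
move=> ARf Uz; rewrite /polfun -(poly_def (d - 2) (fun k => (rpol p f z)`_k)).
apply/polyP => k; rewrite coef_poly; case: ltnP => // dk.
by rewrite nth_default // (leq_trans (size_rpol ARf Uz)).
Qed.

Let quot_Phi f i z : abelian_relation U p f -> U z -> quot (Phi p f) i z = f i z.
Proof.
move=> ARf Uz; rewrite /quot polfun_Phi // rpol_horner // FpolE.
by rewrite mulfK // Fpol_simple.
Qed.

Lemma Phi_solution f : abelian_relation U p f -> solution U a T (Phi p f).
Proof.
move=> ARf; have [hf _ _ relf] := ARf.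
have hPhi j : holo U (Phi p f j) by exact: holo_Phi.
split=> // z Uz; apply/solution_at => // i.
have nearU := open_nbhs_nbhs (conj oU Uz).
(* [quot (Phi p f)] is known to agree with [f] on [U] only; openness of [U] makes this enough for
   derivatives at [z]. *)
have E1 : dx (quot (Phi p f) i) z = dx (f i) z.
  by apply: near_eq_derive; apply: filterS nearU => w Uw; exact: quot_Phi.
have E2 : dy (fun w => p i w * quot (Phi p f) i w) z = dy (fun w => p i w * f i w) z.
  by apply: near_eq_derive; apply: filterS nearU => w Uw; rewrite quot_Phi.
exact: etrans (congr2 +%R E1 E2) (relf i z Uz).
Qed.

Lemma Phi_inj f h : abelian_relation U p f -> abelian_relation U p h ->
  (forall j z, U z -> Phi p f j z = Phi p h j z) -> forall i z, U z -> f i z = h i z.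
Proof.
move=> ARf ARh fh i z Uz; rewrite -(quot_Phi i ARf Uz) -(quot_Phi i ARh Uz) /quot.
by congr (_.[_] / _); apply: eq_bigr => j _; rewrite fh.
Qed.

Lemma Phi_surj r : solution U a T r ->
  exists f, abelian_relation U p f /\ forall j z, U z -> Phi p f j z = r j z.
Proof.
move=> [hr rP]; exists (quot r).
have rpolE z : U z -> rpol p (quot r) z = polfun r z.
  move=> Uz; rewrite [RHS](lagrange_ell (t_inj Uz)).
    by rewrite -FP // FpolE.
  by rewrite (leq_trans (size_polfun _ _)) //; lia.
(* The Lagrange form of r has size at most d - 2, which is equivalent to the two linear conditions
   on its coefficients. *)
have sums z (Uz : U z) :
    \sum_(i < d) quot r i z = 0 /\ \sum_(i < d) p i z * quot r i z = 0.
  apply/(size_sum_ellP (t_inj Uz) (fun i => quot r i z)); first by lia.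
  by have := rpolE z Uz; rewrite /rpol => ->; exact: size_polfun.
split; last first.
  move=> j z Uz; rewrite /Phi rpolE //.
  by have /matrixP/(_ j 0) := polcol_polfun r z; rewrite !mxE.
split=> [i|z Uz|z Uz|i z Uz]; try by have [] := sums z Uz.
  exact: (holo_quotient (fun k => ha _) hr (hp i) (fun w => @Fpol_simple w i)).
by move: i; apply/solution_at => //; exact: rP.
Qed.

End Web.

Theorem theorem1 (R : realType) (d : nat) (U : set (C2 R))
  (a : 'I_d.+1 -> C2 R -> Cx R) (p : 'I_d -> C2 R -> Cx R)
  (T : C2 R -> 'M[R[i]]_(d - 1, d)) :
  (3 <= d)%N ->
  open U ->
  (forall i, holo U (a i)) ->
  (forall z, U z -> a ord0 z = 1) ->
  (forall i, holo U (p i)) ->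
  (forall z i j, U z -> i != j -> p i z != p j z) ->
  (forall z, U z -> Fpol a z = \prod_(i < d) ('X - (p i z : R[i])%:P)) ->
  (forall i j, holo U (fun z => T z i j)) ->
  (forall z, U z -> T z *m Bmx a z = 1%:M) ->
  [/\ (* the map f |-> r is well defined: deg r <= d-3 and r is a solution *)
      forall f, abelian_relation U p f ->
        (forall z, U z -> (size (rpol p f z) <= d - 2)%N) /\
        solution U a T (Phi p f),
      (* it is linear *)
      forall (c : R[i]) f g, abelian_relation U p f -> abelian_relation U p g ->
        forall j z, U z ->
          Phi p (fun i w => c * f i w + g i w) j z = c * Phi p f j z + Phi p g j z,
      (* injective *)
      forall f g, abelian_relation U p f -> abelian_relation U p g ->
        (forall j z, U z -> Phi p f j z = Phi p g j z) ->
        forall i z, U z -> f i z = g i z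
    & (* surjective onto the solution space *)
      forall r, solution U a T r ->
        exists f, abelian_relation U p f /\
          forall j z, U z -> Phi p f j z = r j z].
Proof.
move=> d3 oU ha a0 hp pP FP _ TB.
split.
- move=> f ARf; split=> [z Uz|]; first exact: size_rpol ARf Uz.
  exact: Phi_solution ARf.
- by move=> c f g _ _ j z _; rewrite /Phi rpol_linear coefD coefZ.
- move=> f g; exact: (@Phi_inj _ _ _ a).
- exact: Phi_surj.
Qed.
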